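(* For all integers $d\ge 0$ and $n\ge 1$, the map $\psi$ is a bijection between $\mathcal{P}^d_n$ (the difference $d$ posets on $[n]$) and $\mathcal{A}^d_n$ (the $d$-ascent sequences of length $n$). Furthermore, $\mathrm{Act}(P)=\mathrm{dAsc}(\psi(P))$ for all $P\in\mathcal{P}^d_n$.
   Context: Fix an integer $d\ge 0$; $[n]=\{1,\dots,n\}$, and $[a,b]=\{a,a+1,\dots,b\}$ (empty if $a>b$). $d$-ascent sequences: for an integer sequence $x=x_1\cdots x_n$, an index $i$ ($1\le i\le n-1$) is a $d$-ascent of $x$ if $x_{i+1}>x_i-d$; $\mathrm{dAsc}(x)$ is the set, and $\mathrm{dasc}(x)$ the number, of $d$-ascents of $x$. The sequence $x$ is a $d$-ascent sequence if $x_1=0$ and $0\le x_i\le \mathrm{dasc}(x_1\cdots x_{i-1})+1$ for all $2\le i\le n$. $\mathcal{A}^d_n$ is the set of $d$-ascent sequences of length $n$. Factorial posets: a poset $P$ on $[n]$ with strict order $<_P$ is factorial if for all $i,j,k\in[n]$: $i<j$ and $j<_P k$ imply $i<_P k$. (Then $i<_P j$ implies $i<j$.) Define $\omega(P)=a_1\cdots a_n$ by $a_i=0$ if $i$ is a minimal element of $P$, and $a_i=\max\{j: j<_P i\}$ otherwise. Let $\mathcal{A}(P)=\{a_i : a_i>0\}$. Active elements: for a factorial poset $P$ on $[n]$ with $\omega(P)=a_1\cdots a_n$, process $k=1,2,\dots,n-1$ in order: $k$ is inactive if $a_{k+1}\le a_k$ and there are at least $d$ active elements in $[a_{k+1}+1,a_k]$;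 otherwise $k$ is active. The element $n$ is set to be inactive. $\mathrm{Act}(P)$ is the set of active elements and $\mathrm{act}(P)=|\mathrm{Act}(P)|$. Difference $d$ posets: a factorial poset $P$ is a difference $d$ poset if $\mathcal{A}(P)\subseteq \mathrm{Act}(P)$. $\mathcal{P}^d_n$ is the set of difference $d$ posets on $[n]$. The map $\psi$: for $P$ on $[n]$, let $P[n-1]$ be the induced subposet on $[n-1]$; its active elements are computed with $P[n-1]$ as a factorial poset on $[n-1]$. If $P\in\mathcal{P}^d_n$, $n\ge2$, then $P[n-1]\in\mathcal{P}^d_{n-1}$ and $a_n\in\{0,n-1\}\cup\mathrm{Act}(P[n-1])$. For $n=1$ set $\psi(P)=0$. For $n\ge 2$, with $\psi(P[n-1])=x_1\cdots x_{n-1}$, set $\psi(P)=x_1\cdots x_{n-1}x_n$, where $x_n=0$ if $a_n=0$; $x_n=\mathrm{act}(P[n-1])+1$ if $a_n=n-1$; and $x_n=i$ if $a_n$ is the $i$-th smallest element of $\mathrm{Act}(P[n-1])$. *)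

(* Defs.v *)
From mathcomp Require Import all_boot all_order all_algebra.
From mathcomp Require Import classical_sets.

Set Implicit Arguments.
Unset Strict Implicit.
Unset Printing Implicit Defensive.

Local Open Scope nat_scope.

(* Words are written x_1 ... x_n, hence indexed from 1. *)
Definition letter (T : Type) (x0 : T) (x : seq T) (i : nat) : T := nth x0 x i.-1.

(* Subsets of [n] = {1, ..., n} that have to be enumerated (dAsc, Act) are
   represented by their increasing sequences of elements. *)
Definition dAsc (d : nat) (x : seq int) : seq nat :=
  [seq i <- iota 1 (size x).-1
     | (letter 0 x i - d%:Z < letter 0 x i.+1)%R].

Definition dasc (d : nat) (x : seq int) : nat := size (dAsc d x).

Definition ascent_sequence (d : nat) (x : seq int) : Prop :=
  letter 0%R x 1 = 0%R /\
  forall i, 2 <= i <= size x ->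
    (0 <= letter 0 x i <= (dasc d (take i.-1 x))%:Z + 1)%R.

Definition ascent_sequences (d n : nat) : set (seq int) :=
  [set x : seq int | size x = n /\ ascent_sequence d x]%classic.

(* A binary relation on [n] is given by its graph, the ordinal i : 'I_n
   standing for the element i + 1 of [n]. *)
Definition relation_on (n : nat) : Type := {set 'I_n * 'I_n}.

Definition strict_order (n : nat) (P : relation_on n) : Prop :=
  (forall i, (i, i) \notin P) /\
  (forall i j k, (i, j) \in P -> (j, k) \in P -> (i, k) \in P).

Definition factorial_poset (n : nat) (P : relation_on n) : Prop :=
  strict_order P /\
  forall i j k : 'I_n, i < j -> (j, k) \in P -> (i, k) \in P.

(* For a minimal element the maximum is empty, hence 0. *)
Definition omega (n : nat) (P : relation_on n) : seq nat :=
  [seq \max_(j < n | (j, i) \in P) j.+1 | i <- enum 'I_n].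

Definition inactive_step (d : nat) (a s : seq nat) (k : nat) : bool :=
  let: ak := letter 0 a k in
  let: ak1 := letter 0 a k.+1 in
  (ak1 <= ak) && (d <= count (fun j => ak1 + 1 <= j <= ak) s).

(* The active elements among 1, ..., k. When k is processed, the interval
   [a_{k+1} + 1, a_k] lies below k, so that only elements already processed
   are counted. *)
Fixpoint active_upto (d : nat) (a : seq nat) (k : nat) : seq nat :=
  if k is k'.+1 then
    let s := active_upto d a k' in
    if inactive_step d a s k then s else rcons s k
  else [::].

(* The element n is always inactive. *)
Definition Act (d n : nat) (P : relation_on n) : seq nat :=
  active_upto d (omega P) n.-1.

Definition act (d n : nat) (P : relation_on n) : nat := size (Act d P).

Definition difference_poset (d n : nat) (P : relation_on n) : Prop :=
  factorial_poset P /\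
  forall a, a \in omega P -> 0 < a -> a \in Act d P.

Definition difference_posets (d n : nat) : set (relation_on n) :=
  [set P : relation_on n | difference_poset d P]%classic.

Arguments difference_posets d n : clear implicits.

(* The induced relation P[n] on [n], for P on [n + 1]. *)
Definition restrict (n : nat) (P : relation_on n.+1) : relation_on n :=
  [set ij : 'I_n * 'I_n |
     (widen_ord (leqnSn n) ij.1, widen_ord (leqnSn n) ij.2) \in P].

(* The last letter of psi P for P on [n + 1] with n >= 1. As Act is increasing,
   its i-th smallest element is the one at (0-based) index i - 1. *)
Definition psi_last (d n : nat) (P : relation_on n.+1) : nat :=
  let: a := letter 0 (omega P) n.+1 in
  let: Q := restrict P in
  if a == 0 then 0
  else if a == n then (act d Q).+1
  else (index a (Act d Q)).+1.

(* Defined on all relations; the value for n = 0 and the value of psi_last when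
   a_n lies outside {0, n - 1} and Act (P[n - 1]) are irrelevant: the latter
   does not occur on difference d posets. *)
Fixpoint psi (d n : nat) {struct n} : relation_on n -> seq int :=
  match n return relation_on n -> seq int with
  | 0 => fun _ => [::]
  | n'.+1 => fun P =>
      if n' == 0 then [:: 0%R]
      else rcons (psi d (restrict P)) (psi_last d P)%:Z%R
  end.

(* Main.v *)
(** A factorial poset [P] is encoded by [a = omega P], since [j <_P i] iff
    [j <= a_i].  Let [A = Act P].  On difference d posets every [a_i] lies in
    [A] or is [0], and [psi P] has the closed form
    [x_i = #{s in A | s <= a_i}].  Hence [a_{k+1} <= a_k] together with
    [d <= #{s in A | a_{k+1} < s <= a_k}] amounts to [x_{k+1} + d <= x_k], so [k]
    is inactive exactly when it is not a d-ascent.  As [A = dAsc (psi P)] can be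
    read off [psi P], and the ranks [x_i] in [A] determine the [a_i], [psi] is
    injective.  Conversely, for a d-ascent sequence [x], letting [a_i] be the
    [x_i]-th smallest element of [dAsc x] defines a preimage. *)

Require Import Defs.
From mathcomp Require Import all_boot all_order all_algebra.
From mathcomp Require Import classical_sets functions.
From mathcomp Require Import zify.

(** * Ranks: counting the elements of a list up to a bound *)

Lemma count_leq_lt {A : seq nat} {y z : nat} :
  y < z -> z \in A -> count (fun s => s <= y) A < count (fun s => s <= z) A.
Proof.
move=> yz zA; have -> : count (fun s => s <= z) A =
    count (fun s => s <= y) A + count (fun s => y < s <= z) A.
  rewrite -(count_predUI (fun s => s <= y)) [X in _ + X](_ : _ = 0).
    by rewrite addn0; apply: eq_count => s /=; lia.
  by rewrite (eq_count (a2 := pred0)) ?count_pred0 // => s /=; lia.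
rewrite -[X in X < _]addn0 ltn_add2l -has_count.
by apply/hasP; exists z; rewrite // yz leqnn.
Qed.

(** Of two distinct values the larger is positive, hence in [A], so its count is strictly larger. *)
Lemma count_leq_inj (A : seq nat) (y z : nat) :
  (0 < y -> y \in A) -> (0 < z -> z \in A) ->
  count (fun s => s <= y) A = count (fun s => s <= z) A -> y = z.
Proof.
move=> yA zA e; case: (ltngtP y z) => // lt.
  by have := count_leq_lt lt (zA (leq_ltn_trans (leq0n _) lt)); rewrite e ltnn.
by have := count_leq_lt lt (yA (leq_ltn_trans (leq0n _) lt)); rewrite e ltnn.
Qed.

(** Turns the test of [inactive_step] into a comparison of ranks. When [y < z], membership of [z] in
    [A] makes the rank of [z] exceed that of [y], so both sides fail. *)
Lemma count_interval_ge (d : nat) (A : seq nat) (y z : nat) :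
  (0 < z -> z \in A) ->
  (z <= y) && (d <= count (fun j => z + 1 <= j <= y) A) =
  (count (fun s => s <= z) A + d <= count (fun s => s <= y) A).
Proof.
move=> zA; case: (leqP z y) => [zy|yz] /=.
  have -> : count (fun s => s <= y) A =
      count (fun s => s <= z) A + count (fun j => z + 1 <= j <= y) A.
    rewrite -(count_predUI (fun s => s <= z)) [X in _ + X](_ : _ = 0).
      by rewrite addn0; apply: eq_count => s /=; lia.
    by rewrite (eq_count (a2 := pred0)) ?count_pred0 // => s /=; lia.
  by rewrite leq_add2l.
have := count_leq_lt yz (zA (leq_ltn_trans (leq0n _) yz)); lia.
Qed.

Lemma count_leq_sorted (A : seq nat) (y : nat) :
  sorted ltn A -> y \in A -> count (fun s => s <= y) A = (index y A).+1.
Proof.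
elim: A => // b A IH /= pA; rewrite inE eq_sym.
have bA : {in A, forall s, b < s} by apply/allP/(order_path_min ltn_trans).
case: eqVneq => [<- _|ne /= yA].
  rewrite leqnn (eq_in_count (a2 := pred0)) ?count_pred0 // => s /bA /=; lia.
by rewrite IH ?(path_sorted pA) // ltnW ?bA.
Qed.

Lemma count_filter_iota (p q : pred nat) (m m' : nat) :
  m <= m' -> (forall j, p j -> j <= m) ->
  count p (filter q (iota 1 m)) = count p (filter q (iota 1 m')).
Proof.
move=> mm' pm; rewrite -(subnKC mm') iotaD filter_cat count_cat.
rewrite [X in _ + X](_ : _ = 0) ?addn0 //.
rewrite (eq_in_count (a2 := pred0)) ?count_pred0 // => j.
rewrite mem_filter mem_iota => jm /=; apply/negP => /pm; lia.
Qed.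

Lemma filter_iotaS (q : pred nat) (m : nat) :
  filter q (iota 1 m.+1) =
  filter q (iota 1 m) ++ (if q m.+1 then [:: m.+1] else [::]).
Proof. by rewrite -[in LHS](addn1 m) iotaD filter_cat add1n. Qed.

(** * Active elements and d-ascents as filters of an interval *)

Definition active (d : nat) (a : seq nat) (k : nat) : bool :=
  ~~ inactive_step d a (active_upto d a k.-1) k.

Lemma active_uptoE (d : nat) (a : seq nat) (m : nat) :
  active_upto d a m = filter (active d a) (iota 1 m).
Proof.
elim: m => // m IH; rewrite filter_iotaS -IH /= /active /=.
by case: inactive_step; rewrite /= ?cats0 ?cats1.
Qed.

Lemma sorted_filter_iota (q : pred nat) (m : nat) :
  sorted ltn (filter q (iota 1 m)).
Proof. exact/(sorted_filter ltn_trans)/iota_ltn_sorted. Qed.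

(** Deciding [k] involves the letter at [k.+1], so agreement is required one position beyond [m]. *)
Lemma eq_active_upto (d : nat) (a b : seq nat) (m : nat) :
  (forall k, 1 <= k <= m.+1 -> letter 0 a k = letter 0 b k) ->
  active_upto d a m = active_upto d b m.
Proof.
elim: m => // m IH ab /=; rewrite IH; last by move=> k km; apply: ab; lia.
by rewrite /inactive_step !ab ?ltnS ?leqnSn ?leqnn.
Qed.

Definition ascent (d : nat) (x : seq int) (i : nat) : bool :=
  (letter 0 x i - d%:Z < letter 0 x i.+1)%R.

Lemma dAsc_take (d : nat) (x : seq int) (m : nat) :
  m <= size x -> dAsc d (take m x) = filter (ascent d x) (iota 1 m.-1).
Proof.
move=> mx; rewrite /dAsc size_take_min (minn_idPl mx).
apply: eq_in_filter => i; rewrite mem_iota => im.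
by rewrite /ascent /letter !nth_take //; lia.
Qed.

(** * From words to rank sequences *)

(** A word [a] is the image under [omega] of a factorial poset iff [a_i < i]. *)
Definition difference_seq (d : nat) (a : seq nat) : Prop :=
  (forall i, 1 <= i <= size a -> letter 0 a i < i) /\
  (forall i, 1 <= i <= size a -> 0 < letter 0 a i ->
     letter 0 a i \in active_upto d a (size a).-1).

Definition rank_seq (A : seq nat) (a : seq nat) : seq int :=
  [seq Posz (count (fun s => s <= letter 0 a i) A) | i <- iota 1 (size a)].

Lemma size_rank_seq (A a : seq nat) : size (rank_seq A a) = size a.
Proof. by rewrite size_map size_iota. Qed.

Lemma letter_rank_seq (A a : seq nat) (i : nat) : 1 <= i <= size a ->
  letter 0%R (rank_seq A a) i = Posz (count (fun s => s <= letter 0 a i) A).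
Proof.
move=> ia; rewrite /letter (nth_map 0) ?size_iota ?nth_iota; try lia.
by rewrite add1n prednK //; case/andP: ia.
Qed.

(** Since [letter 0 a k < k], the tested interval lies below [k], and truncating the set at [k.-1]
    changes no count. [q] is arbitrary so that it can be [active d a] or, for surjectivity, the
    d-ascents of a given word. *)
Lemma active_ascent (d : nat) (a : seq nat) (q : pred nat) (k : nat) :
  let A := filter q (iota 1 (size a).-1) in
  1 <= k < size a -> letter 0 a k < k ->
  (0 < letter 0 a k.+1 -> letter 0 a k.+1 \in A) ->
  ascent d (rank_seq A a) k =
  ~~ inactive_step d a (filter q (iota 1 k.-1)) k.
Proof.
move=> A ka ak aA; rewrite /inactive_step (count_filter_iota _ _ _ (size a).-1).
- rewrite -/A count_interval_ge // /ascent !letter_rank_seq; lia.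
- lia.
- by move=> j; lia.
Qed.

Lemma dAsc_rank_seq (d : nat) (a : seq nat) : difference_seq d a ->
  let A := active_upto d a (size a).-1 in
  forall m, m < size a -> active_upto d a m =
    filter (ascent d (rank_seq A a)) (iota 1 m).
Proof.
move=> [alt aA] A m ma; rewrite active_uptoE; apply: eq_in_filter => k.
rewrite mem_iota => km; rewrite /active {}/A !active_uptoE.
rewrite -active_ascent ?alt //; try lia.
by rewrite -active_uptoE; apply: aA; lia.
Qed.

Lemma dAsc_rank (d : nat) (a : seq nat) : difference_seq d a ->
  let A := active_upto d a (size a).-1 in dAsc d (rank_seq A a) = A.
Proof.
move=> Da A; rewrite -{1}[rank_seq A a]take_size dAsc_take // size_rank_seq.
case: (posnP (size a)) => [a0|a0]; first by rewrite /A a0.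
by rewrite -dAsc_rank_seq // prednK.
Qed.

(** For [i >= 2], [a_i < i] makes the rank of [a_i] count only active elements up to [i - 1]. Those
    up to [i - 2] are the d-ascents of the prefix of length [i - 1], and [i - 1] adds at most
    one. *)
Lemma rank_seq_ascent (d : nat) (a : seq nat) : 0 < size a ->
  difference_seq d a ->
  ascent_sequence d (rank_seq (active_upto d a (size a).-1) a).
Proof.
move=> a0 Da; have [alt aA] := Da; split.
  rewrite letter_rank_seq ?a0 //; have := alt 1; rewrite a0 => /(_ isT).
  rewrite ltnS leqn0 => /eqP ->; rewrite active_uptoE count_filter.
  rewrite (eq_in_count (a2 := pred0)) ?count_pred0 // => s.
  by rewrite mem_iota /=; lia.
move=> i; rewrite size_rank_seq => ia; rewrite letter_rank_seq; last lia.
rewrite /dasc dAsc_take ?size_rank_seq; last lia.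
rewrite -dAsc_rank_seq //; last lia.
rewrite [X in count _ X]active_uptoE -(count_filter_iota _ _ i.-1); first last.
- by move=> j; have := alt i; lia.
- lia.
rewrite -active_uptoE -[X in count _ (_ X)]prednK /=; last lia.
set s := active_upto _ _ _; set p := fun _ => _.
have := count_size p s; case: inactive_step => ps; first lia.
by rewrite -cats1 count_cat /=; case: (p _); lia.
Qed.

Lemma rank_seq_inj (d : nat) (a b : seq nat) :
  difference_seq d a -> difference_seq d b ->
  rank_seq (active_upto d a (size a).-1) a =
  rank_seq (active_upto d b (size b).-1) b -> a = b.
Proof.
move=> Da Db e; have sab : size a = size b.
  by rewrite -(size_rank_seq (active_upto d a (size a).-1) a) e size_rank_seq.
have eA : active_upto d a (size a).-1 = active_upto d b (size b).-1.
  by rewrite -dAsc_rank // e dAsc_rank.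
have [_ aA] := Da; have [_ bA] := Db.
apply: (@eq_from_nth _ 0) => // i ia; rewrite -[i]/(i.+1.-1).
apply: (count_leq_inj (active_upto d a (size a).-1)).
- exact: aA.
- by rewrite eA; apply: bA; rewrite -sab.
- have := congr1 (fun x => letter 0%R x i.+1) e.
  by rewrite /= !letter_rank_seq -?sab // eA sab; case.
Qed.

(** * Preimages of d-ascent sequences *)

Lemma ascent_sequence_ge0 (d : nat) (x : seq int) (i : nat) :
  ascent_sequence d x -> 1 <= i <= size x -> (0 <= letter 0 x i)%R.
Proof.
move=> [x1 xi] ix; case: (ltnP 1 i) => i1.
  by have /andP[] := xi i ltac:(lia).
have -> : i = 1 by lia.
by rewrite x1.
Qed.

(** If [x_{i+1}] attains its bound [dasc (x_1 ... x_i) + 1], then [i] is itself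
    a d-ascent; hence the uniform bound by the d-ascents among [1, ..., i]. *)
Lemma ascent_sequence_le (d : nat) (x : seq int) (i : nat) :
  ascent_sequence d x -> i < size x ->
  (letter 0 x i.+1 <= (size (filter (ascent d x) (iota 1 i)))%:Z)%R.
Proof.
move=> Ax; have [x1 xi] := Ax; elim: i => [|i IH] ix; first by rewrite x1.
have {IH} := IH (ltnW ix).
have /andP[_] := xi i.+2 ltac:(lia).
rewrite /dasc dAsc_take; last lia.
rewrite filter_iotaS size_cat /=.
case: ifPn; rewrite /ascent /=; lia.
Qed.

Lemma rank_seq_surj (d : nat) (x : seq int) : ascent_sequence d x ->
  exists a, [/\ size a = size x, difference_seq d a &
    rank_seq (active_upto d a (size a).-1) a = x].
Proof.
move=> Ax; set A := dAsc d x.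
have AE : A = filter (ascent d x) (iota 1 (size x).-1) by [].
(* The [0] in front of [A] sends rank 0 to the letter 0 and rank [r] to the [r]-th smallest element
   of [A]. *)
pose a := [seq nth 0 (0 :: A) `|y|%N | y <- x].
have sa : size a = size x by rewrite size_map.
have la i : 1 <= i <= size x ->
    letter 0 a i = nth 0 (0 :: A) `|letter 0%R x i|%N.
  by move=> ix; rewrite /letter (nth_map (Posz 0)) //; lia.
have xle i : 1 <= i <= size x ->
    `|letter 0%R x i|%N <= size (filter (ascent d x) (iota 1 i.-1)).
  move=> ix; have := ascent_sequence_ge0 _ _ _ Ax ix.
  have := ascent_sequence_le _ _ i.-1 Ax ltac:(lia).
  by rewrite prednK; lia.
(* The d-ascents below [i] form a prefix of [A] with at least [x_i] elements, so the lookup of a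
   positive [x_i] stays inside it; this gives [a_i < i]. *)
have Acat i : 1 <= i <= size x -> A = filter (ascent d x) (iota 1 i.-1) ++
    filter (ascent d x) (iota i ((size x).-1 - i.-1)).
  move=> ix; rewrite AE -[in LHS](@subnKC i.-1 (size x).-1); last lia.
  by rewrite iotaD filter_cat add1n prednK //; case/andP: ix.
have alt i : 1 <= i <= size x -> letter 0 a i < i.
  move=> ix; rewrite la //; have := xle i ix.
  case: `|_|%N => [|m] /= mA; first lia.
  rewrite (Acat i ix) nth_cat mA.
  have := mem_nth 0 mA; rewrite mem_filter mem_iota => /andP[_].
  by move: (nth _ _ _) => b; lia.
have aA i : 1 <= i <= size x -> 0 < letter 0 a i -> letter 0 a i \in A.
  move=> ix; rewrite la //; have := xle i ix.
  case: `|_|%N => [|m] //= mA _; apply: mem_nth.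
  by rewrite (Acat i ix) size_cat ltn_addr.
have xE : rank_seq A a = x.
  apply: (@eq_from_nth int 0%R); rewrite size_rank_seq // => i ia.
  rewrite -[i]/(i.+1.-1) [LHS]letter_rank_seq // la -?sa //.
  have := xle i.+1; rewrite -sa ia => /(_ isT).
  have := ascent_sequence_ge0 _ _ i.+1 Ax; rewrite -sa ia => /(_ isT).
  rewrite /letter /=; case: (nth 0%R x i) => // m _ /=.
  case: m => [|m] /= mA.
    rewrite (eq_in_count (a2 := pred0)) ?count_pred0 // => s.
    by rewrite AE mem_filter mem_iota /=; lia.
  have mA' : m < size A by rewrite (Acat i.+1) ?size_cat ?ltn_addr // -sa.
  have sA : sorted ltn A by exact: sorted_filter_iota.
  rewrite count_leq_sorted ?mem_nth // index_uniq //.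
  exact: sorted_uniq ltn_trans ltnn _ sA.
(* Only now is [A] identified with the active set: by induction the active elements up to [m] are
   d-ascents of [x], and [active_ascent] with [q := ascent d x] decides [m.+1]. *)
have aE m : m < size x ->
    active_upto d a m = filter (ascent d x) (iota 1 m).
  elim: m => // m IH mx; rewrite filter_iotaS /= IH; last lia.
  have := active_ascent d a (ascent d x) m.+1.
  rewrite /= sa -AE xE => -> //; [|by apply: alt; lia|by apply: aA; lia].
  by case: inactive_step; rewrite /= ?cats0 ?cats1.
have actA : active_upto d a (size x).-1 = A.
  case: (posnP (size x)) => [x0|x0]; first by rewrite AE x0.
  by rewrite aE ?prednK.
by exists a; rewrite /difference_seq sa actA.
Qed.

(** * Factorial posets and their words [omega P] *)

Lemma size_omega (n : nat) (P : relation_on n) : size (omega P) = n.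
Proof. by rewrite size_map size_enum_ord. Qed.

Lemma letter_omega (n : nat) (P : relation_on n) (i : 'I_n) :
  letter 0 (omega P) i.+1 = \max_(j < n | (j, i) \in P) j.+1.
Proof.
by rewrite /letter /omega (nth_map i) ?size_enum_ord //= nth_ord_enum.
Qed.

(** If [j < i], factoriality would turn [i <_P j] into [j <_P j]. *)
Lemma factorial_lt (n : nat) (P : relation_on n) (i j : 'I_n) :
  factorial_poset P -> (i, j) \in P -> i < j.
Proof.
move=> [[irr _] fac] ij; case: (ltngtP i j) => // [ji|/val_inj e].
  by have := irr j; rewrite (fac _ _ _ ji ij).
by have := irr j; rewrite -{1}e ij.
Qed.

Lemma omega_lt (n : nat) (P : relation_on n) (i : nat) :
  factorial_poset P -> 1 <= i <= n -> letter 0 (omega P) i < i.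
Proof.
case: i => // i FP /= ix; rewrite (letter_omega n P (Ordinal ix)) ltnS.
by apply/bigmax_leqP => j; apply: factorial_lt.
Qed.

(** By factoriality the elements below [j] form an initial segment, determined by its maximum. The
    ordinal [i] stands for [i + 1], hence the strict inequality. *)
Lemma omegaP (n : nat) (P : relation_on n) (i j : 'I_n) : factorial_poset P ->
  ((i, j) \in P) = (i < letter 0 (omega P) j.+1).
Proof.
move=> FP; rewrite letter_omega; apply/idP/idP => [ij|].
  by apply: (bigmax_sup i).
case: (pickP (fun k : 'I_n => (k, j) \in P)) => [k0 k0j|no].
  rewrite (bigmax_eq_arg k0) //; case: arg_maxnP => // k kj _.
  rewrite ltnS leq_eqVlt => /orP[/eqP/val_inj -> //|ik].
  by have [_ fac] := FP; exact: fac kj.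
by rewrite big_pred0.
Qed.

Lemma omega_inj (n : nat) (P Q : relation_on n) :
  factorial_poset P -> factorial_poset Q -> omega P = omega Q -> P = Q.
Proof. by move=> FP FQ e; apply/setP => -[i j]; rewrite !omegaP // e. Qed.

Lemma omega_surj (a : seq nat) :
  (forall i, 1 <= i <= size a -> letter 0 a i < i) ->
  exists2 P : relation_on (size a), factorial_poset P & omega P = a.
Proof.
move=> alt; pose P : relation_on (size a) :=
  [set ij : 'I_(size a) * 'I_(size a) | ij.1 < letter 0 a ij.2.+1].
have ale (i : 'I_(size a)) : letter 0 a i.+1 <= i.
  by rewrite -ltnS alt // ltn_ord.
have FP : factorial_poset P.
  split; [split=> [i|i j k]|move=> i j k ij]; rewrite !inE /=.
  - by rewrite -leqNgt.
  (* Transitivity: [i < letter 0 a j.+1 <= j < letter 0 a k.+1]. *)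
  - by move=> ij jk; have := ale j; lia.
  - by move=> jk; lia.
exists P => //; apply: (@eq_from_nth _ 0); rewrite size_omega // => i ia.
rewrite -[i]/(i.+1.-1) -/(letter _ _ _) (letter_omega _ P (Ordinal ia)).
apply/eqP; rewrite eqn_leq; apply/andP; split.
  by apply/bigmax_leqP => j; rewrite inE.
rewrite [i.+1.-1]/= -[i]/(i.+1.-1) -/(letter 0 a i.+1).
have := ale (Ordinal ia) => /=; case e: (letter 0 a i.+1) => [//|b] bi.
(* A positive letter [b.+1] is attained in the maximum by the ordinal [b]. *)
have ba : b < size a by lia.
by apply: (bigmax_sup (Ordinal ba)); rewrite // inE /= e.
Qed.

(** * Restriction and the closed form of [psi] *)

Lemma difference_posetP (d n : nat) (P : relation_on n) :
  difference_poset d P <-> factorial_poset P /\ difference_seq d (omega P).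
Proof.
rewrite /difference_seq size_omega /Act; split=> -[FP].
  move=> aA; split=> //; split=> i ia; first exact: omega_lt.
  by apply/aA/mem_nth; rewrite size_omega; lia.
move=> [_ aA]; split=> // b bP; rewrite -(nth_index 0 bP).
have := index_mem b (omega P); rewrite bP size_omega => bn.
exact: (aA (index b (omega P)).+1).
Qed.

Lemma factorial_restrict (n : nat) (P : relation_on n.+1) :
  factorial_poset P -> factorial_poset (Defs.restrict P).
Proof.
move=> [[irr tr] fac]; split; [split=> [i|i j k]|move=> i j k ij].
- by rewrite inE.
- by rewrite !inE; apply: tr.
- by rewrite !inE; apply: fac.
Qed.

Lemma letter_omega_restrict (n : nat) (P : relation_on n.+1) (i : nat) :
  factorial_poset P -> 1 <= i <= n ->
  letter 0 (omega (Defs.restrict P)) i = letter 0 (omega P) i.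
Proof.
case: i => // i FP /= ix; rewrite (letter_omega n _ (Ordinal ix)).
rewrite -[i]/(widen_ord (leqnSn n) (Ordinal ix) : nat) letter_omega.
rewrite [RHS]big_mkcond big_ord_recr -big_mkcond /=.
case: ifPn => [/(factorial_lt _ _ _ _ FP) /=|_]; first lia.
by rewrite maxn0; apply: eq_bigl => j; rewrite inE.
Qed.

(** For [i <= n] the letter [a_i] is less than [n], whereas the active sets of [P] and of its
    restriction differ at most in [n]. *)
Lemma difference_poset_restrict (d n : nat) (P : relation_on n.+1) :
  difference_poset d P -> difference_poset d (Defs.restrict P).
Proof.
rewrite !difference_posetP => -[FP]; rewrite /difference_seq !size_omega.
move=> [alt aA]; have FQ := factorial_restrict _ _ FP.
split=> //; split=> i ia; first exact: omega_lt.
rewrite letter_omega_restrict // => a0.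
rewrite (eq_active_upto d _ (omega P)); last first.
  by move=> k km; apply: letter_omega_restrict => //; lia.
have := aA i ltac:(lia) a0; have := alt i ltac:(lia).
by rewrite !active_uptoE !mem_filter !mem_iota => ? /andP[-> ?]; lia.
Qed.

(** [P] has the active elements of its restriction and possibly [n]. If the last letter is [n], then
    [n] is active and all active elements are counted; if it is smaller, [n] is not counted. *)
Lemma psi_lastE (d n : nat) (P : relation_on n.+1) : 0 < n ->
  difference_poset d P ->
  psi_last d P = count (fun s => s <= letter 0 (omega P) n.+1) (Act d P).
Proof.
move=> n0 /difference_posetP[FP]; rewrite /difference_seq size_omega.
move=> [alt aA]; rewrite /psi_last /act /Act /=.
have -> : active_upto d (omega (Defs.restrict P)) n.-1 =
    active_upto d (omega P) n.-1.
  by apply: eq_active_upto => k kn; apply: letter_omega_restrict => //; lia.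
have := alt n.+1; have := aA n.+1; rewrite ltnSn /=.
set a := letter _ _ _ => aact a_n; case: eqP => [-> |a0].
  rewrite active_uptoE (eq_in_count (a2 := pred0)) ?count_pred0 // => s.
  by rewrite mem_filter mem_iota /=; lia.
have sE b : active_upto d b n =
    if active d b n then rcons (active_upto d b n.-1) n
    else active_upto d b n.-1.
  by rewrite -[in LHS](prednK n0) /= prednK // /active; case: inactive_step.
have ain : a \in active_upto d (omega P) n by apply: aact; lia.
case: eqP => [an|an].
  rewrite (eq_in_count (a2 := predT)) ?count_predT; last first.
    by move=> s; rewrite active_uptoE mem_filter mem_iota /=; lia.
  rewrite sE; move: ain; rewrite active_uptoE mem_filter an => /andP[-> _].
  by rewrite size_rcons.
have ain' : a \in active_upto d (omega P) n.-1.
  by move: ain; rewrite !active_uptoE !mem_filter !mem_iota => /andP[-> ?]; lia.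
rewrite [in RHS]active_uptoE -(count_filter_iota _ _ n.-1) -?active_uptoE.
- by rewrite count_leq_sorted // active_uptoE sorted_filter_iota.
- lia.
- by move=> j; lia.
Qed.

Lemma psiE (d n : nat) (P : relation_on n) :
  difference_poset d P -> psi d P = rank_seq (Act d P) (omega P).
Proof.
rewrite /rank_seq size_omega; elim: n P => // n IH P DP.
have [FP] := (difference_posetP _ _ _).1 DP.
rewrite /difference_seq size_omega => -[alt _].
rewrite [psi _ _]/=; case: eqP => [n0|/eqP].
  by subst n; rewrite /Act.
rewrite -lt0n => n0; rewrite psi_lastE // IH; last first.
  exact: difference_poset_restrict.
have -> : iota 1 n.+1 = rcons (iota 1 n) n.+1.
  by rewrite -[in LHS](addn1 n) iotaD add1n cats1.
rewrite map_rcons; congr rcons; apply/eq_in_map => i; rewrite mem_iota => ix.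
rewrite letter_omega_restrict //.
rewrite /Act (eq_active_upto d _ (omega P)); last first.
  by move=> k km; apply: letter_omega_restrict => //; lia.
(* As [a_i < i <= n], the possible new active element [n] does not affect the earlier ranks. *)
rewrite !active_uptoE (count_filter_iota _ _ n.-1 n) //; first lia.
by move=> j; have := alt i; lia.
Qed.

Theorem theorem3p8 (d n : nat) (hn : (1 <= n)%N) :
  set_bij (difference_posets d n) (ascent_sequences d n) (@psi d n) /\
  (forall P : relation_on n, difference_poset d P ->
     Act d P =i dAsc d (psi d P)).
Proof.
have psiD (P : relation_on n) : difference_poset d P ->
    psi d P = rank_seq (active_upto d (omega P) (size (omega P)).-1) (omega P).
  by move=> DP; rewrite psiE // size_omega.
split; last first.
  move=> P DP k; have [_ Da] := (difference_posetP _ _ _).1 DP.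
  by rewrite psiD // dAsc_rank // size_omega.
split.
- move=> P DP; have [_ Da] := (difference_posetP _ _ _).1 DP.
  rewrite /ascent_sequences /= psiD // size_rank_seq size_omega; split=> //.
  have := rank_seq_ascent d (omega P); rewrite size_omega; exact.
- move=> P Q /set_mem DP /set_mem DQ; rewrite !psiD // => e.
  have [FP Da] := (difference_posetP _ _ _).1 DP.
  have [FQ Db] := (difference_posetP _ _ _).1 DQ.
  exact/omega_inj/(rank_seq_inj _ _ _ Da Db e).
- move=> x [sx /rank_seq_surj[a [sa Da ax]]].
  have [P FP Pa] := omega_surj a Da.1.
  (* [omega_surj] yields a poset on [[size a]], so [n] is replaced by [size a] to make the types
     agree. *)
  move: sx; rewrite -sa => sx; subst n.
  have DP : difference_poset d P by apply/difference_posetP; rewrite Pa.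
  by exists P => //; rewrite psiD // Pa.
Qed.
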